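(* Let $P$ and $Q$ be finite series-parallel posets with $K_P(\mathbf{x})=K_Q(\mathbf{x})$. Then $P$ and $Q$ are isomorphic. (That is, a series-parallel poset is uniquely determined up to isomorphism by its $P$-partition generating function.)
   Context: For a finite poset $(P,\preceq)$, a $P$-partition is a map $\theta\colon P\to\mathbb{Z}^+$ with $\theta(x)\le\theta(y)$ whenever $x\preceq y$, and $K_P(\mathbf{x})=\sum_{\theta} x_1^{|\theta^{-1}(1)|}x_2^{|\theta^{-1}(2)|}\cdots$ summed over all $P$-partitions. The class of series-parallel posets is the smallest class of posets containing the one-element poset and closed under disjoint union $P\sqcup Q$ (relations are those of $P$ and of $Q$) and ordinal sum $P\oplus Q$ (relations are those of $P$, those of $Q$, and $x\prec y$ for all $x\in P$, $y\in Q$). *)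

(* Defs.v *)
From HB Require Import structures.
From mathcomp Require Import all_boot all_order all_algebra finmap.
From mathcomp Require Import boolp classical_sets functions cardinality fsbigop.

Set Implicit Arguments.
Unset Strict Implicit.
Unset Printing Implicit Defensive.

Import Order.TTheory GRing.Theory.

Local Open Scope order_scope.

Definition poset_iso (dP dQ : Order.disp_t)
    (P : finPOrderType dP) (Q : finPOrderType dQ) : Prop :=
  exists2 f : P -> Q, bijective f & {mono f : x y / x <= y}.

(* The two aliases of P + Q carry different orders. *)
Definition disj_union (P Q : Type) : Type := (P + Q)%type.
Definition ord_sum (P Q : Type) : Type := (P + Q)%type.

Fact disj_union_display : Order.disp_t. Proof. exact: (Order.Disp tt tt). Qed.
Fact ord_sum_display : Order.disp_t. Proof. exact: (Order.Disp tt tt). Qed.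

Section SumOrders.
Context (dP dQ : Order.disp_t) (P : finPOrderType dP) (Q : finPOrderType dQ).

Definition disj_union_le (u v : disj_union P Q) : bool :=
  match u, v with
  | inl x, inl y => x <= y
  | inr x, inr y => x <= y
  | _, _ => false
  end.

Definition ord_sum_le (u v : ord_sum P Q) : bool :=
  match u, v with
  | inl x, inl y => x <= y
  | inr x, inr y => x <= y
  | inl _, inr _ => true
  | inr _, inl _ => false
  end.

Fact disj_union_le_refl : reflexive disj_union_le.
Proof. by case=> x /=. Qed.

Fact disj_union_le_anti : antisymmetric disj_union_le.
Proof. by case=> x [] y //= /le_anti ->. Qed.

Fact disj_union_le_trans : transitive disj_union_le.
Proof. by case=> y [] x [] z //=; apply: le_trans. Qed.

Fact ord_sum_le_refl : reflexive ord_sum_le.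
Proof. by case=> x /=. Qed.

Fact ord_sum_le_anti : antisymmetric ord_sum_le.
Proof. by case=> x [] y //= /le_anti ->. Qed.

Fact ord_sum_le_trans : transitive ord_sum_le.
Proof. by case=> y [] x [] z //=; apply: le_trans. Qed.

HB.instance Definition _ := Finite.copy (disj_union P Q) (P + Q)%type.
HB.instance Definition _ := Order.Le_isPOrder.Build disj_union_display
  (disj_union P Q) disj_union_le_refl disj_union_le_anti disj_union_le_trans.

HB.instance Definition _ := Finite.copy (ord_sum P Q) (P + Q)%type.
HB.instance Definition _ := Order.Le_isPOrder.Build ord_sum_display
  (ord_sum P Q) ord_sum_le_refl ord_sum_le_anti ord_sum_le_trans.

End SumOrders.

(* Closure under isomorphism is implicit in "class of posets". *)
Inductive series_parallel :
    forall d : Order.disp_t, finPOrderType d -> Prop :=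
  | sp_point (d : Order.disp_t) (P : finPOrderType d) :
      #|P| = 1%N -> series_parallel P
  | sp_union (dP dQ : Order.disp_t)
      (P : finPOrderType dP) (Q : finPOrderType dQ) :
      series_parallel P -> series_parallel Q ->
      series_parallel (disj_union P Q : finPOrderType _)
  | sp_sum (dP dQ : Order.disp_t)
      (P : finPOrderType dP) (Q : finPOrderType dQ) :
      series_parallel P -> series_parallel Q ->
      series_parallel (ord_sum P Q : finPOrderType _)
  | sp_iso (dP dQ : Order.disp_t)
      (P : finPOrderType dP) (Q : finPOrderType dQ) :
      series_parallel P -> poset_iso P Q -> series_parallel Q.

Definition is_Ppartition (d : Order.disp_t) (P : finPOrderType d)
    (theta : {ffun P -> nat}) : Prop :=
  (forall x, (0 < theta x)%N) /\
  (forall x y, x <= y -> (theta x <= theta y)%N).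

(* m encodes x_1^(m 1) x_2^(m 2) ...; as P-partitions are positive, the index
   0 never occurs in a monomial with nonzero coefficient in K P. *)
Definition monomial := {fsfun nat -> nat with 0%N}.

(* Formal power series over the integers, as coefficient functions. *)
Definition fpseries := monomial -> int.

Definition Ppart_monomial (d : Order.disp_t) (P : finPOrderType d)
    (theta : {ffun P -> nat}) : monomial :=
  [fsfun i in [fset theta x | x in P]%fset => #|[pred x | theta x == i]| | 0%N].

(* The coefficient of m in the sum over all P-partitions theta of
   x^(Ppart_monomial theta); by K_finite this sum has finite support. *)
Definition K (d : Order.disp_t) (P : finPOrderType d) : fpseries :=
  fun m => (\sum_(theta \in [set theta | is_Ppartition theta]%classic)
              (Ppart_monomial (P := P) theta == m)%:Z)%R.

Lemma Ppart_monomialE (d : Order.disp_t) (P : finPOrderType d)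
    (theta : {ffun P -> nat}) (i : nat) :
  Ppart_monomial theta i = #|[pred x | theta x == i]|.
Proof.
rewrite fsfunE; case: ifPn => // ni; apply/esym/eq_card0 => x.
rewrite !inE; apply: contraNF ni => /eqP <-.
by apply/imfsetP; exists x.
Qed.

Lemma K_finite (d : Order.disp_t) (P : finPOrderType d) (m : monomial) :
  finite_set [set theta : {ffun P -> nat} | Ppart_monomial theta = m]%classic.
Proof.
pose g (h : {ffun P -> finsupp m}) : {ffun P -> nat} := [ffun x => val (h x)].
apply: (sub_finite_set (B := (g @` [set: {ffun P -> finsupp m}])%classic)).
  move=> theta /= thm.
  have mth x : theta x \in finsupp m.
    rewrite mem_finsupp -thm Ppart_monomialE -lt0n.
    by apply/card_gt0P; exists x; rewrite !inE.
  exists [ffun x => [` mth x]%fset] => //.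
  by apply/ffunP => x; rewrite !ffunE.
exact/finite_image/finite_finset.
Qed.

Lemma KE (d : Order.disp_t) (P : finPOrderType d) (m : monomial) :
  K P m = Posz #|` fset_set [set theta : {ffun P -> nat} |
                  is_Ppartition theta /\ Ppart_monomial theta = m]%classic|.
Proof.
set A := (X in fset_set X).
have finA : finite_set A by apply: (sub_finite_set _ (@K_finite _ P m)) => theta [].
have -> : K P m = (\sum_(theta \in A) (1%:Z))%R.
  rewrite /K [LHS]fsbig_mkcond [RHS]fsbig_mkcond; apply: eq_fsbigr => theta _.
  rewrite /patch /A; case: eqP => thm.
    congr (if _ then _ else _).
    by apply/idP/idP; rewrite !inE /=; [split|case].
  by rewrite if_same ifF //; apply/negP; rewrite inE => -[_ /thm].
by rewrite fsbig_finite //= big_const_seq count_predT iter_addr_0 natz.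
Qed.

(* Main.v *)
Require Import Defs.
From mathcomp Require Import boolp classical_sets cardinality fsbigop finmap.
From mathcomp Require Import all_boot all_order all_algebra zify.

Set Implicit Arguments.
Unset Strict Implicit.
Unset Printing Implicit Defensive.

Import Order.TTheory GRing.Theory Num.Theory.
Local Open Scope ring_scope.

(* [K_U] is encoded by the numbers of chains of order ideals of [U] with
   prescribed sizes of the successive differences.

   A poset is an ordinal sum with lower summand of size [m] iff it has exactly
   one ideal of size [m]; the counts of both summands are then read off.

   For disjoint unions, [K] (in finitely many variables) is multiplicative with
   values in an integral domain.  Convolution over ideals turns functionals of [K]
   into functionals of [K]; among them is [phi], which vanishes on disconnected
   posets but not on a point or an ordinal sum.  Suppose [K_U = K_V] and let [n] be
   the largest size of a component [W] of [U] or [V], say of [U].  Restricted to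
   ideals of size [n], [phi] acts as a derivation that kills components smaller
   than [n] and sends those of size [n] to constants.  Hence the polynomials
   prod_C (K_C + phi(C) z) over the components [C] of [U] and of [V] (with [phi(C)]
   replaced by 0 if [C] is smaller than [n]) coincide, and their common root
   [- K_W / phi(W)] shows that [K_W] is proportional, hence equal, to [K_W'] for a
   component [W'] of [V].  Cancel [K_W] and induct. *)

(** * Integer polynomials in finitely many variables *)

(** Nesting [{poly _}] yields an integral domain at every level, as the later cancellations
    require. *)
Fixpoint tower (k : nat) : idomainType :=
  if k is k'.+1 then ({poly tower k'} : idomainType) else (int : idomainType).

Fixpoint tower_coef (k : nat) : tower k -> seq nat -> int :=
  match k return tower k -> seq nat -> int with
  | 0 => fun f _ => f
  | k'.+1 => fun (f : {poly tower k'}) b => tower_coef f`_(head 0%N b) (behead b)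
  end.

Lemma tower_coef_inj k (f g : tower k) :
  (forall b, size b = k -> tower_coef f b = tower_coef g b) -> f = g.
Proof.
elim: k f g => [|k IH] f g eqfg; first exact: (eqfg [::]).
by apply/polyP => i; apply: IH => b sb; apply: (eqfg (i :: b)); rewrite /= sb.
Qed.

Lemma tower_coef_sum k (I : finType) (P : pred I) (G : I -> tower k) b :
  tower_coef (\sum_(i | P i) G i) b = \sum_(i | P i) tower_coef (G i) b.
Proof.
elim: k G b => [|k IH] G b //=.
have -> : (\sum_(i | P i) G i : {poly tower k})`_(head 0%N b) =
    \sum_(i | P i) (G i : {poly tower k})`_(head 0%N b).
  exact: coef_sum.
exact: IH.
Qed.

Lemma tower_coefZ k (c : int) (f : tower k) b :
  tower_coef (c%:~R * f) b = c * tower_coef f b.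
Proof.
elim: k f b => [|k IH] f b /=; first by rewrite intz.
have -> : ((c%:~R * f : {poly tower k})`_(head 0%N b)) =
    c%:~R * (f : {poly tower k})`_(head 0%N b).
  by rewrite -(rmorph_int (@polyC (tower k))) coefCM.
exact: IH.
Qed.

Lemma deriv_prod (R : comNzRingType) (I : finType) (p : I -> {poly R}) (S : {set I}) :
  (\prod_(i in S) p i)^`() = \sum_(i in S) (p i)^`() * \prod_(j in S :\ i) p j.
Proof.
move: {2}_.+1 (ltnSn #|S|) => m; elim: m S => // m IH S ltSm.
have [->|/set0Pn[i iS]] := eqVneq S set0; first by rewrite !big_set0 derivC.
rewrite (big_setD1 i) //= derivM [RHS](big_setD1 i) //= IH; last first.
  by move: ltSm; rewrite ltnS (cardsD1 i) iS.
congr (_ + _); rewrite big_distrr /=; apply: eq_bigr => j; rewrite !inE => /andP[nji jS].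
rewrite mulrCA [in RHS](big_setD1 i) /= ?inE ?iS 1?eq_sym ?nji //.
by rewrite !setDDl setUC.
Qed.

(** Evaluating in the fraction field at [- x / y] kills the left side, hence one of the factors on
    the right. *)
Lemma prod_linear_root (R : idomainType) (I : finType) (S : {set I})
    (a b : I -> R) (x y : R) (q : {poly R}) : y != 0 ->
  (x%:P + y *: 'X) * q = \prod_(i in S) ((a i)%:P + b i *: 'X) ->
  exists2 i, i \in S & a i * y = b i * x.
Proof.
move=> y0 /(congr1 (map_poly (@tofrac R))).
pose z := - tofrac x / tofrac y.
have tf0 : tofrac y != 0 by rewrite tofrac_eq0.
have ev u v : (map_poly (@tofrac R) (u%:P + v *: 'X)).[z] = tofrac u + tofrac v * z.
  by rewrite rmorphD /= map_polyC map_polyZ map_polyX !hornerE.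
move/(congr1 (horner^~ z)); rewrite rmorphM rmorph_prod /= hornerM horner_prod ev.
have zy : z * tofrac y = - tofrac x by rewrite /z divfK.
rewrite [tofrac y * z]mulrC zy subrr mul0r => /esym/eqP/prodf_eq0[i iS].
rewrite ev addr_eq0 => /eqP ai; exists i => //; apply/eqP.
by rewrite -tofrac_eq !tofracM ai mulNr -mulrA zy mulrN opprK.
Qed.

Lemma tower_mulrnI k m (f g : tower k) : (0 < m)%N -> f *+ m = g *+ m -> f = g.
Proof.
move=> m_gt0 efg; apply: tower_coef_inj => a _; apply/eqP.
have m0 : m%:Z != 0 by rewrite eqz_nat -lt0n.
by rewrite -(inj_eq (mulfI m0)) -!tower_coefZ !mulr_natl efg.
Qed.

(** The [j]-th derivative at 0 is [j!] times the [j]-th coefficient, and the tower is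
    torsion-free. *)
Lemma derivn_horner0_inj k (p q : {poly tower k}) :
  (forall j, p^`(j).[0] = q^`(j).[0]) -> p = q.
Proof.
move=> eqpq; apply/polyP => j; have := eqpq j.
rewrite !horner_coef0 !coef_derivn addn0; apply: tower_mulrnI.
by rewrite ffactnn fact_gt0.
Qed.

(** * Order ideals and convolution *)

Section Ideals.
Context (d : Order.disp_t) (T : finPOrderType d).
Implicit Types (U V J A B W : {set T}) (x y : T).

(** Subsets of one ambient poset stand for induced subposets, so that passing to [U :\: J] does not
    change the type. *)
Definition ideal U J :=
  (J \subset U) && [forall x in J, forall y in U, (y <= x)%O ==> (y \in J)].

Lemma idealP U J :
  reflect (J \subset U /\ forall x y, x \in J -> y \in U -> (y <= x)%O -> y \in J)
          (ideal U J).
Proof.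
apply: (iffP andP) => -[sJU clJ]; split=> //.
  by move=> x y xJ yU lyx; move/forall_inP/(_ x xJ)/forall_inP/(_ y yU)/implyP: clJ; apply.
by apply/forall_inP => x xJ; apply/forall_inP => y yU; apply/implyP; apply: clJ.
Qed.

Lemma ideal_sub U J : ideal U J -> J \subset U. Proof. by case/andP. Qed.

Lemma ideal0 U : ideal U set0.
Proof. by apply/idealP; split; rewrite ?sub0set // => x y; rewrite inE. Qed.

Lemma idealT U : ideal U U.
Proof. by apply/idealP; split. Qed.

Lemma ideal_trans U J W : ideal U J -> ideal J W -> ideal U W.
Proof.
move=> /idealP[sJU clJ] /idealP[sWJ clW]; apply/idealP; split.
  exact: subset_trans sJU.
move=> x y xW yU lyx; apply: (clW x) => //.
by apply: (clJ x) => //; apply: (subsetP sWJ).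
Qed.

Section Convolution.
Context (R : comNzRingType).
Implicit Types X Y Z : {set T} -> R.

(** The product dual to the coproduct that splits [U] into [J] and [U :\: J] for every ideal [J]. *)
Definition conv X Y U := \sum_(J | ideal U J) X J * Y (U :\: J).

Lemma eq_conv X X' Y Y' U :
  (forall J, ideal U J -> X J = X' J) ->
  (forall J, J \subset U -> Y J = Y' J) -> conv X Y U = conv X' Y' U.
Proof. by move=> eX eY; apply: eq_bigr => J idJ; rewrite eX // eY // subsetDl. Qed.

(** Removing [J] turns the ideals of [U] containing [J] into the ideals of [U :\: J]. This is the
    coassociativity behind [convA]. *)
Lemma sum_ideal_ideal U J (G : {set T} -> R) : ideal U J ->
  \sum_(W | ideal U W && ideal W J) G W = \sum_(W | ideal (U :\: J) W) G (J :|: W).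
Proof.
move=> idJ; have /idealP[sJU clJ] := idJ.
rewrite (reindex_onto (fun W => J :|: W) (fun W => W :\: J)) /=; last first.
  by move=> W /andP[_ /ideal_sub sJW]; rewrite setDE setUIr setUCr setIT; apply/setUidPr.
apply: eq_bigl => W; apply/idP/idP.
  case/andP=> /andP[/idealP[sU clU] _] /eqP eW.
  have sWD : W \subset U :\: J by rewrite -eW setSD.
  apply/idealP; split=> // x y xW; rewrite inE => /andP[yJ yU] lyx.
  have : y \in J :|: W by apply: (clU x) => //; rewrite inE xW orbT.
  by rewrite inE (negPf yJ).
case/idealP=> sW clW.
have sWU : W \subset U by apply: subset_trans sW _; apply: subsetDl.
have dWJ : [disjoint W & J] by move: sW; rewrite subsetD => /andP[].
apply/andP; split; last first.
  rewrite setDUl setDv set0U; apply/eqP/setDidPl; exact: dWJ.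
apply/andP; split; apply/idealP; split.
- by rewrite subUset sJU.
- move=> x y; rewrite !inE => /orP[xJ|xW] yU lyx; first by rewrite (clJ x).
  case: (boolP (y \in J)) => //= yJ; apply: (clW x) => //.
  by rewrite inE yJ.
- exact: subsetUl.
- by move=> x y xJ yJW lyx; apply: (clJ x) => //; apply: subsetP yJW; rewrite subUset sJU.
Qed.

Lemma convA X Y Z U : conv X (conv Y Z) U = conv (conv X Y) Z U.
Proof.
rewrite /conv; under [RHS]eq_bigr do rewrite big_distrl /=.
rewrite (exchange_big_dep (ideal U)) /=; last exact: ideal_trans.
apply: eq_bigr => J idJ; rewrite sum_ideal_ideal // big_distrr /=.
apply: eq_bigr => W /ideal_sub sW.
have dWJ : [disjoint W & J] by move: sW; rewrite subsetD => /andP[].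
rewrite mulrA; congr (_ * _ * _); last by rewrite setDDl.
by rewrite setDUl setDv set0U; congr Y; apply/esym/setDidPl.
Qed.

Lemma conv1l Y U : conv (fun J => (J == set0)%:R) Y U = Y U.
Proof.
rewrite /conv (bigD1 set0) ?ideal0 //= eqxx mul1r setD0 big1 ?addr0 // => J /andP[_ /negPf->].
by rewrite mul0r.
Qed.

Lemma sum_ideal_U (G : {set T} -> R) U :
  \sum_(J | ideal U J) G J = G U + \sum_(J | ideal U J && (J != U)) G J.
Proof. by rewrite (bigD1 U) ?idealT. Qed.

Lemma sum_ideal_0 (G : {set T} -> R) U :
  \sum_(J | ideal U J) G J = G set0 + \sum_(J | ideal U J && (J != set0)) G J.
Proof. by rewrite (bigD1 set0) ?ideal0. Qed.

End Convolution.

(** * Chain counts *)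

(** The coefficient of [K_U] with exponents [a], written as an iterated convolution of size
    indicators. *)
Fixpoint nchains (a : seq nat) : {set T} -> int :=
  if a is m :: a' then conv (fun J => (#|J| == m)%:R) (nchains a')
  else fun U => (U == set0)%:R.

Lemma nchains_cat a b U : nchains (a ++ b) U = conv (nchains a) (nchains b) U.
Proof.
elim: a U => [|m a IH] U; first by rewrite conv1l.
by rewrite -convA; apply: eq_conv.
Qed.

Lemma nchains1 m U : nchains [:: m] U = (#|U| == m)%:R.
Proof.
rewrite /= /conv sum_ideal_U setDv eqxx mulr1 big1 ?addr0 // => J /andP[idJ nJU].
rewrite setD_eq0 [U \subset J]negbTE ?mulr0 //.
by apply: contra nJU => sUJ; rewrite eqEsubset sUJ ideal_sub.
Qed.

Lemma cardsD_ideal U J : ideal U J -> #|U :\: J| = (#|U| - #|J|)%N.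
Proof. by move=> /ideal_sub sJ; rewrite cardsD; congr (_ - #|pred_of_set _|)%N; apply/setIidPr. Qed.

Lemma nchains_eq0 a U : #|U| != sumn a -> nchains a U = 0.
Proof.
elim: a U => [|m a IH] U /=; first by rewrite cards_eq0 => /negPf->.
move=> nU; rewrite /conv big1 // => J idJ; case: eqP => [eJ|]; last by rewrite mul0r.
rewrite mul1r IH // cardsD_ideal // eJ; apply: contra nU => /eqP <-.
by rewrite subnKC // -eJ subset_leq_card // ideal_sub.
Qed.

Arguments nchains : simpl never.

Lemma nchains_cons m a U : nchains (m :: a) U = conv (fun J => (#|J| == m)%:R) (nchains a) U.
Proof. by []. Qed.

Lemma nchains_0 a U : nchains (0%N :: a) U = nchains a U.
Proof. by rewrite -[RHS]conv1l; apply: eq_conv => // J _; rewrite cards_eq0. Qed.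

Lemma nchains_filter a U : nchains a U = nchains [seq m <- a | m != 0%N] U.
Proof.
elim: a U => [|m a IH] U //=; case: eqP => [->|_] /=; first by rewrite -IH -[RHS]nchains_0.
exact: eq_conv.
Qed.

Lemma nchains_rcons0 a k U : nchains (a ++ nseq k 0%N) U = nchains a U.
Proof.
rewrite nchains_filter [RHS]nchains_filter filter_cat; congr (nchains _ U).
by elim: k => [|k IH] //=; rewrite cats0.
Qed.

(* Compositions of length [#|T|] already determine all chain counts, because
   zero entries can be inserted and removed. *)
Lemma nchains_ext k U V : (#|T| <= k)%N ->
  (forall a, size a = k -> nchains a U = nchains a V) -> forall a, nchains a U = nchains a V.
Proof.
move=> leTk eqN a; rewrite nchains_filter [RHS]nchains_filter; set b := filter _ _.
have szb : (size b <= sumn b)%N.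
  have : all (fun m => m != 0%N) b by apply: filter_all.
  by elim: b => //= m b IH /andP[m0 /IH leb]; rewrite -add1n leq_add // lt0n.
have [leb|ltb] := leqP (size b) k.
  rewrite -(nchains_rcons0 b (k - size b)) -[RHS](nchains_rcons0 b (k - size b)).
  by apply: eqN; rewrite size_cat size_nseq subnKC.
have nsum W : #|W| != sumn b.
  rewrite neq_ltn (leq_ltn_trans (max_card _)) //.
  exact: leq_trans (leq_ltn_trans leTk ltb) szb.
by rewrite !nchains_eq0.
Qed.

(** * Functionals determined by the chain counts *)

Section KFunctionals.
Context (R : comNzRingType).
Implicit Types X Y : {set T} -> R.

(** The combination is chosen before [U], so the value depends on [U] only through its chain
    counts. *)
Definition Kfun X :=
  exists s : seq (R * seq nat), forall U, X U = \sum_(p <- s) p.1 * (nchains p.2 U)%:~R.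

Lemma Kfun_eqN X U V : Kfun X -> (forall a, nchains a U = nchains a V) -> X U = X V.
Proof. by case=> s sX eN; rewrite !sX; apply: eq_bigr => p _; rewrite eN. Qed.

Lemma Kfun_ext X Y : X =1 Y -> Kfun X -> Kfun Y.
Proof. by move=> eXY [s sX]; exists s => U; rewrite -eXY. Qed.

Lemma Kfun_sub X Y : Kfun X -> Kfun Y -> Kfun (fun U => X U - Y U).
Proof.
case=> s sX [t tY]; exists (s ++ [seq (- p.1, p.2) | p <- t]) => U.
rewrite big_cat big_map sX tY /= -sumrN; congr (_ + _).
by apply: eq_bigr => p _; rewrite mulNr.
Qed.

(** By bilinearity this reduces to [nchains_cat]: chain counts convolve by concatenating
    compositions. *)
Lemma Kfun_conv X Y : Kfun X -> Kfun Y -> Kfun (conv X Y).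
Proof.
case=> s sX [t tY]; exists [seq (p.1 * q.1, p.2 ++ q.2) | p <- s, q <- t] => U.
rewrite big_allpairs_dep /= /conv.
under [LHS]eq_bigr do rewrite sX big_distrl /=.
rewrite exchange_big /=; apply: eq_bigr => p _.
under [LHS]eq_bigr do rewrite tY big_distrr /=.
rewrite exchange_big /=; apply: eq_bigr => q _.
rewrite nchains_cat rmorph_sum /= big_distrr /=; apply: eq_bigr => J _.
by rewrite rmorphM /= mulrACA.
Qed.

(** Sizes are bounded by [#|T|], so finitely many one-part chain counts interpolate [g]. *)
Lemma Kfun_card (g : nat -> R) : Kfun (fun U => g #|U|).
Proof.
exists [seq (g m, [:: m]) | m <- iota 0 #|T|.+1] => U.
have Ui : #|U| \in iota 0 #|T|.+1 by rewrite mem_iota ltnS max_card.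
rewrite big_map (bigD1_seq _ Ui (iota_uniq _ _)) /=.
rewrite nchains1 eqxx mulr1 big1 ?addr0 // => m nm.
by rewrite nchains1 eq_sym (negPf nm) mulr0.
Qed.

Definition down x : {set T} := [set y | (y <= x)%O].

(** By antisymmetry this is 1 if [U] has a greatest element and 0 otherwise; as a count it can be
    summed over [x]. *)
Definition psi U : R := #|[set x in U | U \subset down x]|%:R.

Lemma ideal_down U x : ideal U (U :&: down x).
Proof.
apply/idealP; split=> [|y z]; first exact: subsetIl.
by rewrite !inE => /andP[_ lyx] zU lzy; rewrite zU (le_trans lzy).
Qed.

(** The only ideal with greatest element [x] is [U :&: down x], so the sum over ideals becomes a sum
    over elements. *)
Lemma conv_psi Y U : conv psi Y U = \sum_(x in U) Y (U :\: down x).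
Proof.
rewrite /conv; transitivity (\sum_(J | ideal U J)
    \sum_(x in U | (x \in J) && (J \subset down x)) Y (U :\: J)).
  apply: eq_bigr => J idJ; rewrite sumr_const mulr_natl; congr (_ *+ _).
  apply: eq_card => x; rewrite !inE [RHS]unfold_in.
  by case xJ: (x \in J); rewrite ?andbF //= (subsetP (ideal_sub idJ)).
rewrite (exchange_big_dep (mem U)) /=; last by move=> J x _ /andP[].
apply: eq_bigr => x xU; rewrite (big_pred1 (U :&: down x)).
  by rewrite setDIr setDv set0U.
move=> J /=; rewrite xU /=; apply/idP/eqP.
  case/and3P=> /idealP[sJU clJ] xJ sJx; apply/eqP; rewrite eqEsubset subsetI sJU sJx /=.
  by apply/subsetP => y; rewrite !inE => /andP[yU lyx]; apply: (clJ x).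
by move->; rewrite ideal_down !inE xU lexx subsetIr.
Qed.

(* [psi * 1] is the cardinality, which can be solved for [psi] by induction on
   the size because [psi U] itself is one of the summands. *)
Lemma Kfun_psi : Kfun psi.
Proof.
suff [X [KX eX]] : exists X, Kfun X /\ forall U, (#|U| < #|T|.+1)%N -> X U = psi U.
  by apply: Kfun_ext KX => U; rewrite eX // ltnS max_card.
elim: #|T|.+1 => [|m [X [KX eX]]].
  by exists (fun=> 0); split=> //; apply: (Kfun_card (fun=> 0)).
(* The indicator of nonempty [W] drops the summand [J = U], so only proper ideals enter. *)
exists (fun U => #|U|%:R - conv X (fun W => (#|W| != 0%N)%:R) U); split.
  apply: Kfun_sub (Kfun_card (fun n => n%:R)) _.
  exact: Kfun_conv KX (Kfun_card (fun n => (n != 0%N)%:R)).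
move=> U ltU; have := conv_psi (fun=> 1) U.
rewrite sumr_const => <-; rewrite /conv 2!sum_ideal_U setDv cards0 eqxx mulr0 add0r mulr1.
rewrite -addrA -sumrB big1 ?addr0 // => J /andP[idJ nJ].
have pJ : J \proper U by rewrite properEneq nJ ideal_sub.
rewrite eX; last exact: leq_trans (proper_card pJ) ltU.
rewrite cards_eq0 setD_eq0 -[U \subset J]negbK; move: pJ.
by rewrite properE => /andP[_ ->]; rewrite subrr.
Qed.

End KFunctionals.

Lemma Kfun_coef (X : {set T} -> {poly int}) k : Kfun X -> Kfun (fun U => (X U)`_k).
Proof.
case=> s sX; exists [seq ((p.1 : {poly int})`_k, p.2) | p <- s] => U.
rewrite sX big_map coef_sum; apply: eq_bigr => p _.
by rewrite -(rmorph_int (@polyC int)) coefMC.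
Qed.

(** A chain count of [U] vanishes unless its composition sums to [#|U|], so it suffices to keep the
    terms of sum [n]. *)
Lemma Kfun_restrict n (X : {set T} -> int) :
  Kfun X -> Kfun (fun U => if #|U| == n then X U else 0).
Proof.
case=> s sX; exists [seq p <- s | sumn p.2 == n] => U; rewrite big_filter.
case: eqP => [Un|/eqP nU].
  rewrite sX [RHS]big_mkcond; apply: eq_bigr => p _.
  by case: eqP => // /eqP np; rewrite nchains_eq0 ?mulr0 // Un eq_sym.
by rewrite big1 // => p /eqP pn; rewrite nchains_eq0 ?mulr0 // pn.
Qed.

(** * Disjoint unions inside the ambient poset *)

(** Every element is comparable to itself, so this includes disjointness, and [A :|: B] is the
    disjoint union of the two posets. *)
Definition indep A B := forall x y, x \in A -> y \in B -> (x >< y)%O.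

Lemma indep_sym A B : indep A B -> indep B A.
Proof. by move=> AB x y xB yA; rewrite comparable_sym AB. Qed.

Lemma indep_sub A B A' B' :
  A' \subset A -> B' \subset B -> indep A B -> indep A' B'.
Proof. by move=> /subsetP sA /subsetP sB AB x y /sA xA /sB yB; apply: AB. Qed.

Lemma indep_disjoint A B : indep A B -> [disjoint A & B].
Proof.
move=> AB; apply/pred0P => x /=; apply/negbTE/negP => /andP[xA xB].
by have := AB x x xA xB; rewrite comparablexx.
Qed.

Lemma indep_notin A B x : indep A B -> x \in A -> x \notin B.
Proof. by move=> /indep_disjoint/disjointFr AB xA; rewrite AB. Qed.

Lemma indepD A B J W : indep A B -> J \subset A -> W \subset B ->
  (A :|: B) :\: (J :|: W) = (A :\: J) :|: (B :\: W).
Proof.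
move=> AB sJ sW; apply/setP => x; rewrite !inE.
case xA: (x \in A).
  have /negPf xB := indep_notin AB xA.
  by rewrite xB (contraFF (subsetP sW x)) //= ?andbF ?orbF.
case xB: (x \in B); rewrite ?andbF //=.
by rewrite (contraFF (subsetP sJ x)).
Qed.

Lemma cardsU_indep A B : indep A B -> #|A :|: B| = (#|A| + #|B|)%N.
Proof. by move/indep_disjoint/disjoint_setI0=> AB; rewrite cardsU AB cards0 subn0. Qed.

(** An ideal of the union is an arbitrary pair of ideals, recovered by intersecting with [A] and
    with [B]. *)
Lemma sum_ideal_indep (R : comNzRingType) (G : {set T} -> R) A B : indep A B ->
  \sum_(J | ideal (A :|: B) J) G J =
  \sum_(J | ideal A J) \sum_(W | ideal B W) G (J :|: W).
Proof.
move=> AB; rewrite pair_big /=.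
rewrite (reindex_onto (fun p : {set T} * {set T} => p.1 :|: p.2)
                      (fun J => (J :&: A, J :&: B))) /=; last first.
  by move=> J /ideal_sub sJ; rewrite -setIUr; apply/setIidPl.
apply: eq_bigl => -[J W] /=; apply/idP/idP.
  case/andP=> /idealP[sU clU] /eqP[eJ eW].
  apply/andP; split; apply/idealP; split.
  - by rewrite -eJ subsetIr.
  - move=> x y xJ yA lyx; rewrite -eJ inE yA andbT; apply: (clU x) => //.
      by rewrite inE xJ.
    by rewrite inE yA.
  - by rewrite -eW subsetIr.
  - move=> x y xJ yA lyx; rewrite -eW inE yA andbT; apply: (clU x) => //.
      by rewrite inE xJ orbT.
    by rewrite inE yA orbT.
case/andP=> /idealP[sJ clJ] /idealP[sW clW].
apply/andP; split; last first.
  have dAW : W :&: A = set0.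
    by apply: disjoint_setI0; apply/indep_disjoint/indep_sym/(indep_sub (subxx _) sW AB).
  have dJB : J :&: B = set0.
    by apply: disjoint_setI0; apply/indep_disjoint/(indep_sub sJ (subxx _) AB).
  rewrite !setIUl dAW dJB setU0 set0U xpair_eqE.
  by apply/andP; split; apply/eqP/setIidPl.
apply/idealP; split; first by rewrite setUSS.
move=> x y; rewrite !inE => /orP[xJ|xW] /orP[yA|yB] lyx.
- by rewrite (clJ x).
- by have := AB x y (subsetP sJ _ xJ) yB; rewrite /Order.comparable lyx orbT.
- by have := AB y x yA (subsetP sW _ xW); rewrite /Order.comparable lyx.
- by rewrite (clW x) ?orbT.
Qed.

(** * The functional [phi] and its vanishing on disjoint unions *)

(** By [conv_psi], the convolution of [psi] with the character ['X^#|U|]. *)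
Definition tau U : {poly int} := \sum_(x in U) 'X^#|U :\: down x|.

(** [m] is fuel: each unfolding removes a nonempty ideal, so every [m] above [#|U|] gives the same
    value. *)
Fixpoint phi_rec m U : {poly int} :=
  if m is m'.+1 then
    tau U - \sum_(J | ideal U J && (J != set0)) 'X^#|J| * phi_rec m' (U :\: J)
  else 0.

(* With [1_y U = 'X^#|U|] this is the solution of [1_y * phi = psi * 1_y], the
   conjugate of the infinitesimal character [psi] by the character [1_y]. *)
Definition phi := phi_rec #|T|.+1.

Lemma Kfun_phi : Kfun phi.
Proof.
rewrite /phi; elim: #|T|.+1 => [|m IH]; first exact: (Kfun_card (fun=> 0)).
apply: Kfun_sub.
  have Ktau := Kfun_conv (@Kfun_psi {poly int}) (Kfun_card (fun n => 'X^n)).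
  by apply: Kfun_ext Ktau => U; rewrite conv_psi.
have := Kfun_conv (Kfun_card (fun n => (n != 0%N)%:R * 'X^n)) IH.
apply: Kfun_ext => U; rewrite /conv sum_ideal_0 cards0 eqxx !mul0r add0r.
by apply: eq_bigr => J /andP[_ nJ]; rewrite cards_eq0 nJ mul1r.
Qed.

Lemma card_setD_ltn U J : ideal U J -> J != set0 -> (#|U :\: J| < #|U|)%N.
Proof.
move=> idJ nJ; have sJ := ideal_sub idJ; rewrite cardsD_ideal //.
by rewrite ltn_subrL card_gt0 nJ (leq_trans _ (subset_leq_card sJ)) ?card_gt0.
Qed.

Lemma phi_recS m U : (#|U| < m)%N -> phi_rec m.+1 U = phi_rec m U.
Proof.
elim: m U => // m IH U ltU; rewrite [LHS]/= [RHS]/=; congr (_ - _).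
apply: eq_bigr => J /andP[idJ nJ]; congr (_ * _); apply: IH.
exact: leq_trans (card_setD_ltn idJ nJ) ltU.
Qed.

Lemma phiE U :
  phi U = tau U - \sum_(J | ideal U J && (J != set0)) 'X^#|J| * phi (U :\: J).
Proof. by rewrite {1}/phi -phi_recS // ltnS max_card. Qed.

Lemma phi_tau U : \sum_(J | ideal U J) 'X^#|J| * phi (U :\: J) = tau U.
Proof. by rewrite sum_ideal_0 cards0 expr0 mul1r setD0 phiE subrK. Qed.

Lemma phi0 : phi set0 = 0.
Proof.
rewrite phiE /tau big_set0 big1 ?subr0 // => J /andP[/ideal_sub].
by rewrite subset0 => ->.
Qed.

(** For [x] in [A], removing [down x] leaves all of [B], which accounts for the factor ['X^#|B|];
    likewise for [x] in [B]. *)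
Lemma tau_indep A B : indep A B ->
  tau (A :|: B) = 'X^#|B| * tau A + 'X^#|A| * tau B.
Proof.
move=> AB; rewrite /tau (eq_bigl [predU A & B]); last by move=> x; rewrite !inE.
rewrite bigU ?indep_disjoint //=.
rewrite !big_distrr /=; congr (_ + _); apply: eq_bigr => x xA.
  rewrite -exprD setDUl cardsU_indep; last by apply: indep_sub AB; rewrite ?subsetDl.
  rewrite addnC; congr ('X^(#|pred_of_set _| + _)).
  apply/setP => y; rewrite !inE; case yB: (y \in B); rewrite ?andbF //=.
  by have := AB x y xA yB; rewrite /Order.comparable negb_or => /andP[_ ->].
rewrite -exprD setDUl cardsU_indep; last by apply: indep_sub AB; rewrite ?subsetDl.
congr ('X^(#|pred_of_set _| + _)).
apply/setP => y; rewrite !inE; case yA: (y \in A); rewrite ?andbF //=.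
by have := AB y x yA xA; rewrite /Order.comparable negb_or => /andP[-> _].
Qed.

(** Expand [phi_tau] over pairs [(J, W)]. Those with [J = A] or [W = B] already add up to
    [tau (A :|: B)]; the others vanish by induction, except [(set0, set0)], whose term
    [phi (A :|: B)] must therefore be 0. *)
Lemma phi_indep A B : indep A B -> A != set0 -> B != set0 -> phi (A :|: B) = 0.
Proof.
move: {2}_.+1 (ltnSn #|A :|: B|) => m; elim: m A B => // m IH A B ltm AB nA nB.
have := phi_tau (A :|: B); rewrite sum_ideal_indep // tau_indep //.
set H := fun J W => 'X^#|J| * ('X^#|W| * phi ((A :\: J) :|: (B :\: W))).
have -> : \sum_(J | ideal A J) \sum_(W | ideal B W)
    'X^#|J :|: W| * phi ((A :|: B) :\: (J :|: W)) =
    \sum_(J | ideal A J) \sum_(W | ideal B W) H J W.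
  apply: eq_bigr => J /ideal_sub sJ; apply: eq_bigr => W /ideal_sub sW.
  rewrite indepD // cardsU_indep; last exact: indep_sub AB.
  by rewrite exprD -mulrA.
rewrite sum_ideal_U /=.
have -> : \sum_(W | ideal B W) H A W = 'X^#|A| * tau B.
  by rewrite -phi_tau big_distrr /=; apply: eq_bigr => W _; rewrite /H setDv set0U.
under eq_bigr do rewrite sum_ideal_U.
rewrite big_split /=.
(* The omitted term [J = A] is a multiple of [phi set0 = 0]. *)
have -> : \sum_(J | ideal A J && (J != A)) H J B = 'X^#|B| * tau A.
  rewrite -phi_tau sum_ideal_U setDv phi0 mulr0 add0r big_distrr /=.
  by apply: eq_bigr => J _; rewrite /H setDv setU0 mulrCA.
have H0 J W : ideal A J -> J != A -> ideal B W -> W != B ->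
    (J != set0) || (W != set0) -> H J W = 0.
  move=> idJ nJA idW nWB nJW; rewrite /H IH ?mulr0 //.
  - move: ltm; rewrite ltnS cardsU_indep // cardsU_indep; last first.
      by apply: indep_sub AB; rewrite ?subsetDl.
    apply: leq_trans; case/orP: nJW => nz.
      by rewrite -addSn leq_add ?card_setD_ltn ?subset_leq_card ?subsetDl.
    by rewrite -addnS leq_add ?card_setD_ltn ?subset_leq_card ?subsetDl.
  - by apply: indep_sub AB; rewrite ?subsetDl.
  - by rewrite setD_eq0; apply: contra nJA => sA; rewrite eqEsubset sA ideal_sub.
  - by rewrite setD_eq0; apply: contra nWB => sB; rewrite eqEsubset sB ideal_sub.
rewrite (bigD1 set0) /=; last by rewrite ideal0 eq_sym.
rewrite (bigD1 set0) /=; last by rewrite ideal0 eq_sym.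
rewrite {1}/H cards0 expr0 !mul1r !setD0 [X in _ + X + _]big1; last first.
  by move=> W /andP[/andP[idW nWB] nW]; apply: H0; rewrite ?ideal0 ?nW ?orbT // eq_sym.
rewrite [X in _ + _ + X]big1 ?addr0; last first.
  move=> J /andP[/andP[idJ nJA] nJ]; rewrite big1 // => W /andP[idW nWB].
  by apply: H0; rewrite ?nJ.
rewrite addrA ['X^#|A| * _ + _]addrC => e.
by apply: (addrI ('X^#|B| * tau A + 'X^#|A| * tau B)); rewrite addr0.
Qed.

(** All exponents in [tau U] are at least [#|U| - m]. In the recursion, removing [J] lowers this
    bound by [#|J|], and the factor ['X^#|J|] restores it. *)
Lemma phi_coef_eq0 m i U : (forall x, x \in U -> (#|U :&: down x| <= m)%N) ->
  (i + m < #|U|)%N -> (phi U)`_i = 0.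
Proof.
move: {2}_.+1 (ltnSn #|U|) => k; elim: k U i => // k IH U i ltUk leUm ltiU.
rewrite phiE coefB /tau !coef_sum big1 ?sub0r => [|x xU]; last first.
  rewrite coefXn; case: eqP => // ei; move: ltiU.
  by rewrite ei cardsD ltnNge -leq_subLR subKn ?leUm // subset_leq_card ?subsetIl.
rewrite big1 ?oppr0 // => J /andP[idJ nJ]; rewrite coefXnM; case: ltnP => // leJi.
have sJ := subset_leq_card (ideal_sub idJ).
apply: IH.
- exact: leq_trans (card_setD_ltn idJ nJ) ltUk.
- move=> x; rewrite inE => /andP[_ /leUm]; apply: leq_trans.
  by apply/subset_leq_card/setSI/subsetDl.
- by rewrite cardsD_ideal // ltn_subRL addnA subnKC.
Qed.

(** * Nonvanishing of [phi] on connected posets *)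

Definition ordsum A B := forall x y, x \in A -> y \in B -> (x < y)%O.

(** For series-parallel posets this is connectedness. *)
Definition conn U := (exists x, U = [set x]) \/
  exists A B, [/\ A != set0, B != set0, ordsum A B & U = A :|: B].

Lemma conn_neq0 U : conn U -> U != set0.
Proof.
case=> [[x ->]|[A [B [nA _ _ ->]]]]; first by apply/set0Pn; exists x; rewrite inE.
by rewrite setU_eq0 (negPf nA).
Qed.

(* A nonempty ideal of an ordinal sum meets the lower summand, hence removing it
   shrinks every principal ideal of maximal size. *)
Lemma conn_down_ltn U J x mu : conn U ->
  (forall y, y \in U -> (#|U :&: down y| <= mu)%N) ->
  ideal U J -> J != set0 -> x \in U :\: J -> (#|(U :\: J) :&: down x| < mu)%N.
Proof.
case=> [[z ->]|[A [B [nA nB AB ->]]]] lemu /idealP[sJ clJ] nJ.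
  have /set0Pn[j jJ] := nJ; have := subsetP sJ _ jJ; rewrite inE => /eqP ejz.
  by rewrite !inE => /andP[xJ /eqP exz]; rewrite exz -ejz jJ in xJ.
have [a aA aJ] : exists2 a, a \in A & a \in J.
  have /set0Pn[j jJ] := nJ; have := subsetP sJ _ jJ; rewrite inE => /orP[jA|jB].
    by exists j.
  have /set0Pn[a aA] := nA; exists a => //; apply: (clJ j) => //.
    by rewrite inE aA.
  exact/ltW/AB.
rewrite inE => /andP[xJ xU]; have := xU; rewrite inE => /orP[xA|xB].
  have /set0Pn[b bB] := nB; have ltxb := AB x b xA bB.
  apply: leq_trans (lemu b _); last by rewrite inE bB orbT.
  apply: proper_card; apply/properP; split.
    apply/subsetP => y; rewrite !inE => /andP[/andP[_ ->] lyx] /=.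
    exact: ltW (le_lt_trans lyx ltxb).
  exists b; first by rewrite !inE bB orbT lexx.
  by rewrite !inE (lt_geF ltxb) andbF.
apply: leq_trans (lemu x xU); apply: proper_card; apply/properP; split.
  by apply: setSI; apply: subsetDl.
exists a; first by rewrite !inE aA ltW // AB.
by rewrite !inE aJ.
Qed.

(** Let [mu] be the largest size of a principal ideal. In degree [#|U| - mu], [tau U] counts the
    elements attaining [mu]. After removing a nonempty ideal all principal ideals are smaller than
    [mu], so by [phi_coef_eq0] the correction terms start in higher degree. *)
Lemma phi_conn U : conn U -> exists k, (phi U)`_k != 0.
Proof.
move=> cU; have /set0Pn[x0 x0U] := conn_neq0 cU.
have [x memx maxx] := arg_maxnP (fun x => #|U :&: down x|) x0U.
have {memx} xU : x \in U := memx.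
set mu := #|U :&: down x| in maxx.
exists (#|U| - mu)%N; rewrite phiE coefB.
have mu_gt0 : (0 < mu)%N by apply/card_gt0P; exists x; rewrite !inE xU lexx.
have lemu : (mu <= #|U|)%N by apply/subset_leq_card/subsetIl.
rewrite [X in _ - X](_ : _ = 0) ?subr0.
  rewrite /tau coef_sum (bigD1 x) //= coefXn cardsD eqxx.
  rewrite gt_eqF // ltr_wpDr // sumr_ge0 // => y _.
  by rewrite coefXn ler0n.
rewrite coef_sum big1 // => J /andP[idJ nJ]; rewrite coefXnM; case: ltnP => // leJ.
apply: (@phi_coef_eq0 mu.-1) => [y yUJ|].
  by rewrite -ltnS prednK // (conn_down_ltn cU).
rewrite cardsD_ideal //.
have lt1 : (0 < #|J|)%N by rewrite card_gt0.
lia.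
Qed.

(** * The generating function in finitely many variables *)

(** [K_U] in [L] variables, the outermost one marking the size of the lowest ideal. *)
Fixpoint chain_poly L : {set T} -> tower L :=
  match L return {set T} -> tower L with
  | 0 => fun U => (U == set0)%:R : int
  | L'.+1 => fun U =>
      (\sum_(J | ideal U J) 'X^#|J| * (chain_poly L' (U :\: J))%:P : {poly tower L'})
  end.

Lemma coef_chain_poly L a U : size a = L -> tower_coef (chain_poly L U) a = nchains a U.
Proof.
elim: L a U => [|L IH] [|m a] // U [sa].
have -> : tower_coef (chain_poly L.+1 U) (m :: a) =
          tower_coef (\sum_(J | ideal U J && (#|J| == m)) chain_poly L (U :\: J)) a.
  rewrite [LHS]/=; congr (tower_coef _ _); rewrite coef_sum [RHS]big_mkcondr.
  by apply: eq_bigr => J _; rewrite coefMC coefXn eq_sym; case: eqP => _; rewrite ?mul1r ?mul0r.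
rewrite tower_coef_sum nchains_cons /conv [LHS]big_mkcondr; apply: eq_bigr => J _.
by rewrite IH //; case: eqP => _; rewrite ?mul1r ?mul0r.
Qed.

Lemma chain_poly_indep L A B :
  indep A B -> chain_poly L (A :|: B) = chain_poly L A * chain_poly L B.
Proof.
elim: L A B => [|L IH] A B AB /=.
  by rewrite setU_eq0; case: (A == set0); rewrite ?mul1r ?mul0r.
rewrite sum_ideal_indep // big_distrl; apply: eq_bigr => J idJ /=.
rewrite big_distrr; apply: eq_bigr => W idW /=.
have sJ := ideal_sub idJ; have sW := ideal_sub idW.
rewrite indepD // cardsU_indep; last exact: indep_sub AB.
rewrite IH; last by apply: indep_sub AB; rewrite ?subsetDl.
by rewrite polyCM exprD mulrACA.
Qed.

Lemma chain_poly_set0 L : chain_poly L set0 = 1.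
Proof.
elim: L => [|L IH] /=; first by rewrite eqxx.
rewrite sum_ideal_0 cards0 setD0 IH mul1r big1 ?addr0 // => J /andP[/ideal_sub].
by rewrite subset0 => ->.
Qed.

Lemma chain_poly_inj L U V : (#|T| <= L)%N -> chain_poly L U = chain_poly L V ->
  forall a, nchains a U = nchains a V.
Proof.
move=> leTL eF; apply: (nchains_ext leTL) => a sa.
by rewrite -(coef_chain_poly U sa) -(coef_chain_poly V sa) eF.
Qed.

(** * The derivation induced by [phi] *)

Section Derivation.
Context (L n k : nat).

(** [n] will be the largest size of a component, and [k] a degree in which [phi] is nonzero on a
    chosen component of that size. *)
Definition phi_coef U : int := if #|U| == n then (phi U)`_k else 0.

Fixpoint iter_deriv j : {set T} -> tower L :=
  if j is j'.+1 then
    fun U => \sum_(J | ideal U J) (phi_coef J)%:~R * iter_deriv j' (U :\: J)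
  else chain_poly L.

Lemma Kfun_coef_iter_deriv j a : size a = L -> Kfun (fun U => tower_coef (iter_deriv j U) a).
Proof.
move=> sa; elim: j => [|j IH] /=.
  exists [:: (1, a)] => U; rewrite big_seq1 mul1r intz; exact: coef_chain_poly.
have Kphi : Kfun phi_coef by apply: Kfun_restrict; apply: Kfun_coef Kfun_phi.
apply: Kfun_ext (Kfun_conv Kphi IH) => U.
by rewrite tower_coef_sum; apply: eq_bigr => J _; rewrite tower_coefZ.
Qed.

Lemma iter_deriv_eqN j U V :
  (forall a, nchains a U = nchains a V) -> iter_deriv j U = iter_deriv j V.
Proof.
move=> eN; apply: tower_coef_inj => a sa.
exact: (Kfun_eqN (Kfun_coef_iter_deriv j sa) eN).
Qed.

End Derivation.

(** * Splitting off a largest component *)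

Implicit Types S : {set {set T}}.

Definition components S :=
  (forall W, W \in S -> conn W) /\
  (forall A B, A \in S -> B \in S -> A != B -> indep A B).

Lemma components_sub S S' :
  S' \subset S -> components S -> components S'.
Proof.
move=> /subsetP sS [cS iS]; split=> [W /sS|A B /sS AS /sS]; [exact: cS|exact: iS].
Qed.

Lemma indep_cover S W : components S -> W \in S -> indep W (cover (S :\ W)).
Proof.
move=> [_ iS] WS x y xW /bigcupP[W']; rewrite !inE => /andP[nW W'S] yW'.
by apply: iS xW yW'; rewrite // eq_sym.
Qed.

Lemma coverD1 S W : components S -> W \in S -> cover S :\: W = cover (S :\ W).
Proof.
move=> cS WS; rewrite /cover (big_setD1 W) //= setDUl setDv set0U.
by apply/setDidPl; rewrite disjoint_sym; apply/indep_disjoint/indep_cover.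
Qed.

Lemma coverE S W : W \in S -> cover S = W :|: cover (S :\ W).
Proof. by move=> WS; rewrite /cover (big_setD1 W). Qed.

Lemma chain_poly_cover L S : components S -> chain_poly L (cover S) = \prod_(W in S) chain_poly L W.
Proof.
move: {2}_.+1 (ltnSn #|S|) => m; elim: m S => // m IH S ltSm cS.
have [->|/set0Pn[W WS]] := eqVneq S set0; first by rewrite /cover !big_set0 chain_poly_set0.
rewrite (coverE WS) chain_poly_indep; last exact: indep_cover.
rewrite (big_setD1 W) //= IH //; last by apply: components_sub cS; apply: subsetDl.
by move: ltSm; rewrite ltnS (cardsD1 W) WS.
Qed.

Section Splitting.
Context (L n k : nat).

Definition bounded S := forall W, W \in S -> (#|W| <= n)%N.

(** If [phi J] is nonzero, [J] lies in a single component by [phi_indep]. Components have at most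
    [n] elements, so a [J] of size [n] is a whole one. *)
Lemma sum_phi_cover S (Y : {set T} -> tower L) : components S -> bounded S ->
  \sum_(J | ideal (cover S) J) (phi_coef n k J)%:~R * Y (cover S :\: J) =
  \sum_(W in S) (phi_coef n k W)%:~R * Y (cover (S :\ W)).
Proof.
move=> cS bS; have [_ iS] := cS; rewrite [LHS]big_mkcond [RHS]big_mkcond /=; apply: eq_bigr => J _.
case: (boolP (J \in S)) => JS.
  rewrite coverD1 // ifT //; apply/idealP; split; first exact: bigcup_sup.
  move=> x y xJ; rewrite (coverE JS) inE => /orP[//|yS] lyx.
  have := indep_cover cS JS xJ yS.
  by rewrite /Order.comparable lyx orbT.
case: ifP => // idJ; rewrite /phi_coef; case: eqP => [Jn|]; last by rewrite mul0r.
suff -> : phi J = 0 by rewrite coef0 mul0r.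
have [->|/set0Pn[j jJ]] := eqVneq J set0; first exact: phi0.
have /bigcupP[W WS jW] := subsetP (ideal_sub idJ) _ jJ.
rewrite -(setID J W); apply: phi_indep.
- move=> x y; rewrite !inE => /andP[_ xW] /andP[yW yJ].
  have /bigcupP[W' W'S yW'] := subsetP (ideal_sub idJ) _ yJ.
  by apply: (iS W W') => //; apply: contraNneq yW => ->.
- by apply/set0Pn; exists j; rewrite inE jJ.
- rewrite setD_eq0; apply: contra JS => sJW.
  suff -> : J = W by [].
  by apply/eqP; rewrite eqEcard sJW Jn bS.
Qed.

Definition split_poly S : {poly tower L} :=
  \prod_(W in S) ((chain_poly L W)%:P + (phi_coef n k W)%:~R *: 'X).

(** Differentiating [split_poly] replaces one factor by its constant [phi_coef], just as
    [sum_phi_cover] removes one component. *)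
Lemma iter_deriv_cover j S : components S -> bounded S ->
  iter_deriv L n k j (cover S) = (split_poly S)^`(j).[0].
Proof.
elim: j S => [|j IH] S cS bS.
  rewrite /= chain_poly_cover // /split_poly horner_prod; apply: eq_bigr => W _.
  by rewrite !hornerE.
rewrite [LHS]/= sum_phi_cover // derivSn /split_poly deriv_prod.
rewrite linear_sum horner_sum /=; apply: eq_bigr => W WS.
rewrite derivD derivC add0r derivZ derivX -scalerAl mul1r derivnZ hornerZ IH //.
  by apply: components_sub cS; apply: subsetDl.
by move=> W'; rewrite inE => /andP[_ /bS].
Qed.

Lemma split_poly_eqN S S' : components S -> bounded S -> components S' -> bounded S' ->
  (forall a, nchains a (cover S) = nchains a (cover S')) -> split_poly S = split_poly S'.
Proof.
move=> cS bS cS' bS' eN; apply: derivn_horner0_inj => j.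
by rewrite -!iter_deriv_cover //; apply: iter_deriv_eqN.
Qed.

End Splitting.

Lemma nchains_card U V : (forall a, nchains a U = nchains a V) -> #|U| = #|V|.
Proof.
by move=> eN; have := eN [:: #|U|]; rewrite !nchains1 eqxx; case: eqP.
Qed.

Lemma nchains_cons0 m k U : nchains (m :: nseq k 0%N) U = (#|U| == m)%:R.
Proof. by rewrite -cat1s nchains_rcons0 nchains1. Qed.

Lemma split_component S S' W : components S -> components S' ->
  bounded #|W| S -> bounded #|W| S' -> W \in S ->
  (forall a, nchains a (cover S) = nchains a (cover S')) ->
  exists2 W', W' \in S' & (forall a, nchains a W = nchains a W') /\
    (forall a, nchains a (cover (S :\ W)) = nchains a (cover (S' :\ W'))).
Proof.
move=> cS cS' bS bS' WS eN; have [k phik] := phi_conn (cS.1 W WS).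
pose L := #|T|.+1; set n := #|W| in bS bS'; pose c := phi_coef n k.
have c1 : c W != 0 by rewrite /c /phi_coef eqxx.
(* At the composition [(m, 0, ..., 0)] the coefficient of [chain_poly L U] is 1 or 0, so scalar
   factors can be read off there. *)
have coefFk U m b : tower_coef (b%:~R * chain_poly L U) (m :: nseq #|T| 0%N) = b * (#|U| == m)%:R.
  by rewrite tower_coefZ coef_chain_poly ?nchains_cons0 // /= size_nseq.
have c1L : (c W)%:~R != 0 :> tower L.
  apply: contraNneq c1 => c0; have := coefFk W n (c W).
  by rewrite c0 eqxx mulr1 => <-; rewrite -[0]/(0%:~R) coefFk mul0r.
have : exists2 W', W' \in S' & chain_poly L W' * (c W)%:~R = (c W')%:~R * chain_poly L W.
  have := split_poly_eqN L k cS bS cS' bS' eN.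
  rewrite {1}/split_poly (big_setD1 W) //=; exact: prod_linear_root.
(* A [W'] of another size has [c W' = 0], and the coefficient at [(#|W'|, 0, ..., 0)] would give
   [c W = 0]. *)
case=> W' W'S'; have [eW'|nW'] := eqVneq #|W'| n; last first.
  rewrite {2}/c /phi_coef (negPf nW') mul0r mulrC => e.
  have := coefFk W' #|W'| (c W); rewrite e -(mul0r (chain_poly L W)) -[0 * _]/(0%:~R * _) coefFk.
  by rewrite eqxx mulr1 mul0r => /esym/eqP; rewrite (negPf c1).
(* Both polynomials have coefficient 1 at [(n, 0, ..., 0)], so proportionality is equality. *)
rewrite mulrC => e; have cc : c W = c W'.
  by have := coefFk W' n (c W); rewrite e coefFk eW' eqxx !mulr1.
rewrite -cc in e; have eF : chain_poly L W' = chain_poly L W by apply: (mulfI c1L).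
exists W' => //; split; first by apply: (@chain_poly_inj L); rewrite // leqnSn.
apply: (@chain_poly_inj L) => //.
have FW0 : chain_poly L W != 0.
  apply/eqP => F0; have := coefFk W n 1.
  by rewrite F0 mulr0 -(mul0r (chain_poly L W)) -[0 * _]/(0%:~R * _) coefFk mul0r eqxx.
apply: (mulfI FW0); rewrite -chain_poly_indep; last exact: indep_cover.
rewrite -eF -chain_poly_indep; last exact: indep_cover.
rewrite -!coverE //; apply: tower_coef_inj => a sa.
by rewrite !coef_chain_poly.
Qed.

(** * Recognizing ordinal sums *)

Definition unique_ideal U J :=
  ideal U J /\ forall J', ideal U J' -> #|J'| = #|J| -> J' = J.

(** An ideal not inside [A] contains a point of [B], hence all of [A], and is too large. *)
Lemma ordsum_unique_ideal A B : ordsum A B -> unique_ideal (A :|: B) A.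
Proof.
move=> AB; split.
  apply/idealP; split=> [|x y xA]; first exact: subsetUl.
  by rewrite inE => /orP[//|yB] lyx; have := lt_geF (AB x y xA yB); rewrite lyx.
move=> J /idealP[sJ clJ] eJ.
have [sJA|/subsetPn[b bJ bA]] := boolP (J \subset A).
  by apply/eqP; rewrite eqEcard sJA eJ leqnn.
have bB : b \in B by have := subsetP sJ _ bJ; rewrite inE (negPf bA).
suff /proper_card : A \proper J by rewrite eJ ltnn.
apply/properP; split; last by exists b.
by apply/subsetP => a aA; apply: (clJ b); rewrite // ?inE ?aA // ltW // AB.
Qed.

(** Otherwise some [j] in [J] is not below some [v] outside. For an extremal such pair, exchanging
    [j] for [v] gives a second ideal of the same size. *)
Lemma unique_ideal_ordsum U J : unique_ideal U J -> ordsum J (U :\: J).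
Proof.
move=> [/idealP[sJ clJ] uJ].
pose bad (p : T * T) := [&& p.1 \in J, p.2 \in U :\: J & ~~ (p.1 <= p.2)%O].
suff nbad p : ~~ bad p.
  move=> x y xJ yU; have := nbad (x, y); rewrite /bad /= xJ yU /= negbK lt_neqAle => ->.
  by rewrite andbT; apply: contraTneq xJ => ->; move: yU; rewrite inE => /andP[].
apply/negP => badp.
(* Maximizing this sum makes [j] maximal in [J] and [v] minimal in [U :\: J]. *)
have [[j v] /and3P[/= jJ]] :=
  arg_maxnP (fun p => #|down p.1| + #|[set y | (p.2 <= y)%O]|)%N badp.
rewrite inE => /andP[vJ vU] njv maxjv.
have jmax x : x \in J -> (j <= x)%O -> x = j.
  move=> xJ ljx; apply/eqP/negPn/negP => nxj.
  have bad' : bad (x, v).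
    rewrite /bad /= xJ inE vJ vU /=; apply: contra njv; exact: le_trans ljx.
  have := maxjv _ bad'; rewrite /= leq_add2r leqNgt => /negP; apply.
  apply: proper_card; apply/properP; split.
    by apply/subsetP => y; rewrite !inE => /le_trans; apply.
  by exists x; rewrite !inE ?lexx // lt_geF // lt_neqAle eq_sym nxj.
have vmin y : y \in U -> (y <= v)%O -> y != v -> y \in J.
  move=> yU lyv nyv; apply/negPn/negP => yJ.
  have bad' : bad (j, y).
    rewrite /bad /= jJ inE yJ yU /=; apply: contra njv => /le_trans; exact.
  have := maxjv _ bad'; rewrite /= leq_add2l leqNgt => /negP; apply.
  apply: proper_card; apply/properP; split.
    by apply/subsetP => z; rewrite !inE; apply: le_trans.
  by exists y; rewrite !inE ?lexx // lt_geF // lt_neqAle nyv.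
suff eJ : v |: (J :\ j) = J by move: vJ; rewrite -eJ !inE eqxx.
apply: uJ; last by rewrite cardsU1 !inE (negPf vJ) andbF (cardsD1 j J) jJ.
apply/idealP; split.
  by apply/subsetP => x; rewrite !inE => /orP[/eqP->//|/andP[_ /(subsetP sJ)]].
move=> x y xJ' yU lyx; rewrite !inE; case: eqVneq => //= nyv.
move: xJ'; rewrite !inE => /orP[/eqP exv|/andP[nxj xJ]].
  rewrite exv in lyx; rewrite vmin // andbT.
  by apply: contraNneq njv => <-.
rewrite (clJ x) // andbT; apply: contraNneq nxj => eyj.
by apply/eqP/jmax; rewrite // -eyj.
Qed.

Lemma nchains_unique_idealr U J a :
  unique_ideal U J -> nchains (#|J| :: a) U = nchains a (U :\: J).
Proof.
move=> [idJ uJ]; rewrite nchains_cons /conv (bigD1 J) //= eqxx mul1r big1 ?addr0 //.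
by move=> W /andP[idW nW]; case: eqP => [/uJ eW|_]; [rewrite eW ?eqxx in nW | rewrite mul0r].
Qed.

Lemma nchains_unique_ideall U J a : unique_ideal U J -> sumn a = #|J| ->
  nchains (rcons a #|U :\: J|) U = nchains a J.
Proof.
move=> [idJ uJ] sa; rewrite -cats1 nchains_cat /conv (bigD1 J) //= nchains1 eqxx mulr1 big1 ?addr0 //.
move=> W /andP[idW nW]; rewrite nchains_eq0 ?mul0r // sa.
by apply: contra nW => /eqP/uJ ->.
Qed.

(** This makes the uniqueness of an ideal of given size visible in the chain counts. *)
Lemma nchains_card_ideals U m : (m <= #|U|)%N ->
  nchains [:: m; (#|U| - m)%N] U = #|[set J | ideal U J && (#|J| == m)]|%:R.
Proof.
move=> lem; rewrite nchains_cons /conv -sum1dep_card natr_sum [RHS]big_mkcondr /=.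
apply: eq_bigr => J idJ.
rewrite -[X in _ * X]/(nchains [:: (#|U| - m)%N] _) nchains1 cardsD_ideal //.
by case: eqP => [->|_]; rewrite ?eqxx ?mul1r ?mul0r.
Qed.

Lemma unique_ideal_eqN U V J : unique_ideal U J -> (forall a, nchains a U = nchains a V) ->
  exists2 J', unique_ideal V J' &
    (forall a, nchains a J = nchains a J') /\
    (forall a, nchains a (U :\: J) = nchains a (V :\: J')).
Proof.
move=> uJ eN; have cUV := nchains_card eN; have [idJ uJ'] := uJ.
have leJ := subset_leq_card (ideal_sub idJ).
have : #|[set W | ideal V W && (#|W| == #|J|)]| == 1%N.
  have := nchains_card_ideals leJ; rewrite eN cUV nchains_card_ideals -?cUV // => /eqP.
  rewrite eqr_nat => /eqP ->; apply/cards1P; exists J; apply/setP => W.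
  rewrite !inE; apply/andP/eqP => [[idW /eqP]|->]; first exact: uJ'.
  by rewrite idJ eqxx.
case/cards1P=> J' eJ'.
have: J' \in [set W | ideal V W && (#|W| == #|J|)] by rewrite eJ' inE.
rewrite inE => /andP[idJ' /eqP cJ'].
have uV : unique_ideal V J'.
  split=> // W idW cW; apply/set1P; rewrite -eJ' inE idW cW cJ' eqxx //.
exists J' => //; split=> a.
  have [sa|na] := eqVneq (sumn a) #|J|; last by rewrite !nchains_eq0 ?cJ' // eq_sym.
  rewrite -(nchains_unique_ideall uJ sa) eN -(nchains_unique_ideall uV) ?cJ' //.
  by rewrite !cardsD_ideal // cUV cJ'.
by rewrite -(nchains_unique_idealr a uJ) eN -cJ' nchains_unique_idealr.
Qed.

(** * Series-parallel subsets and their isomorphisms *)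

(** [f] is total on [T] but constrained only on [U], where reflecting the order makes it
    injective. *)
Definition set_iso U V :=
  exists2 f : T -> T, f @: U = V & {in U &, {mono f : x y / (x <= y)%O}}.

Lemma set_iso_glue A B A' B' (f g : T -> T) : [disjoint A & B] ->
  f @: A = A' -> g @: B = B' ->
  {in A &, {mono f : x y / (x <= y)%O}} -> {in B &, {mono g : x y / (x <= y)%O}} ->
  (forall x y, x \in A -> y \in B ->
     (f x <= g y)%O = (x <= y)%O /\ (g y <= f x)%O = (y <= x)%O) ->
  set_iso (A :|: B) (A' :|: B').
Proof.
move=> dAB fA gB mf mg fg; pose h x := if x \in A then f x else g x.
have hA : {in A, h =1 f} by move=> x xA; rewrite /h xA.
have hB : {in B, h =1 g} by move=> x xB; rewrite /h (disjointFl dAB).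
exists h.
  by rewrite imsetU (eq_in_imset hA) (eq_in_imset hB) fA gB.
move=> x y; rewrite !inE => /orP[xA|xB] /orP[yA|yB].
- by rewrite !hA // mf.
- by rewrite (hA x xA) (hB y yB); case: (fg x y xA yB).
- by rewrite (hB x xB) (hA y yA); case: (fg y x yA xB).
- by rewrite !hB // mg.
Qed.

Lemma set_iso_ordsum A B A' B' : ordsum A B -> ordsum A' B' ->
  set_iso A A' -> set_iso B B' -> set_iso (A :|: B) (A' :|: B').
Proof.
move=> AB AB' [f fA mf] [g gB mg]; apply: (set_iso_glue _ fA gB mf mg).
  apply/pred0P => x /=; apply/negbTE/negP => /andP[xA xB].
  by have := AB x x xA xB; rewrite ltxx.
move=> x y xA yB.
have lt1 := AB x y xA yB.
have lt2 : (f x < g y)%O by apply: AB'; rewrite -?fA -?gB imset_f.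
by rewrite (ltW lt1) (ltW lt2) (lt_geF lt1) (lt_geF lt2).
Qed.

Lemma set_iso_indep A B A' B' : indep A B -> indep A' B' ->
  set_iso A A' -> set_iso B B' -> set_iso (A :|: B) (A' :|: B').
Proof.
move=> AB AB' [f fA mf] [g gB mg]; apply: (set_iso_glue _ fA gB mf mg).
  exact: indep_disjoint.
move=> x y xA yB.
have := AB x y xA yB.
have : (f x >< g y)%O by apply: AB'; rewrite -?fA -?gB imset_f.
by rewrite /Order.comparable !negb_or => /andP[/negPf-> /negPf->] /andP[/negPf-> /negPf->].
Qed.

Inductive spset : {set T} -> Prop :=
  | spset1 x : spset [set x]
  | spsetU A B : spset A -> spset B -> indep A B -> spset (A :|: B)
  | spsetS A B : spset A -> spset B -> ordsum A B -> spset (A :|: B).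

Lemma spset_neq0 U : spset U -> U != set0.
Proof.
elim=> [x|A B _ nA _ _ _|A B _ nA _ _ _]; last 2 first.
- by rewrite setU_eq0 (negPf nA).
- by rewrite setU_eq0 (negPf nA).
- by apply/set0Pn; exists x; rewrite inE.
Qed.

(** Makes the induction applicable to the pieces of a splitting: [W] either meets both summands or
    lies inside one of them. *)
Lemma spset_sub U W : spset U -> W \subset U -> W != set0 -> spset W.
Proof.
move=> spU; elim: spU W => [x W|A B _ IHA _ IHB AB W|A B _ IHA _ IHB AB W].
- by rewrite subset1 => /orP[/eqP->|/eqP->]; [constructor|rewrite eqxx].
- move=> sW nW; rewrite -(setIidPl sW) setIUr.
  have [eA|nA] := eqVneq (W :&: A) set0.
    rewrite eA set0U; apply: IHB; first exact: subsetIr.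
    by apply: contra nW => /eqP eB; rewrite -(setIidPl sW) setIUr eA eB setU0.
  have [eB|nB] := eqVneq (W :&: B) set0.
    by rewrite eB setU0; apply: IHA => //; apply: subsetIr.
  apply: spsetU; [exact: IHA (subsetIr _ _) nA|exact: IHB (subsetIr _ _) nB|].
  by apply: indep_sub AB; apply: subsetIr.
- move=> sW nW; rewrite -(setIidPl sW) setIUr.
  have [eA|nA] := eqVneq (W :&: A) set0.
    rewrite eA set0U; apply: IHB; first exact: subsetIr.
    by apply: contra nW => /eqP eB; rewrite -(setIidPl sW) setIUr eA eB setU0.
  have [eB|nB] := eqVneq (W :&: B) set0.
    by rewrite eB setU0; apply: IHA => //; apply: subsetIr.
  apply: spsetS; [exact: IHA (subsetIr _ _) nA|exact: IHB (subsetIr _ _) nB|].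
  by move=> x y; rewrite !inE => /andP[_ xA] /andP[_ yB]; apply: AB.
Qed.

Lemma conn_components U : conn U -> components [set U].
Proof. by move=> cU; split=> [W|A B]; rewrite !inE => /eqP-> // /eqP->; rewrite eqxx. Qed.

Lemma spset_components U : spset U -> exists2 S, components S & cover S = U.
Proof.
elim=> [x|A B _ [S1 cS1 <-] _ [S2 cS2 <-] AB|A B spA _ spB _ AB].
- exists [set [set x]]; last by rewrite /cover big_set1.
  by apply: conn_components; left; exists x.
- exists (S1 :|: S2); last first.
    apply/setP => x; rewrite inE; apply/bigcupP/orP.
      by case=> W; rewrite inE => /orP[WS|WS] xW; [left|right]; apply/bigcupP; exists W.
    by case=> /bigcupP[W WS xW]; exists W; rewrite // inE WS ?orbT.
  have AB' W1 W2 : W1 \in S1 -> W2 \in S2 -> indep W1 W2.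
    by move=> WS1 WS2; apply: indep_sub AB; apply: bigcup_sup.
  case: cS1 cS2 => c1 i1 [c2 i2]; split.
    by move=> W; rewrite inE => /orP[/c1|/c2].
  move=> W1 W2; rewrite !inE => /orP[W1S|W1S] /orP[W2S|W2S] nW.
  + exact: i1.
  + exact: AB'.
  + exact/indep_sym/AB'.
  + exact: i2.
- exists [set A :|: B]; last by rewrite /cover big_set1.
  by apply: conn_components; right; exists A, B; rewrite !spset_neq0.
Qed.

Lemma spset_set_iso U V :
  spset U -> spset V -> (forall a, nchains a U = nchains a V) -> set_iso U V.
Proof.
move: {2}_.+1 (ltnSn #|U|) => m; elim: m U V => // m IH U V ltU spU spV eN.
(* Common to both kinds of splitting: the induction hypothesis applies to the two matched pairs of
   smaller pieces. *)
have step (X X' : {set T}) : X \subset U -> X' \subset V -> X != set0 -> U :\: X != set0 ->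
    (forall a, nchains a X = nchains a X') ->
    (forall a, nchains a (U :\: X) = nchains a (V :\: X')) ->
    set_iso X X' /\ set_iso (U :\: X) (V :\: X').
  move=> sX sX' nX nD eX eD; have cX := nchains_card eX; have cD := nchains_card eD.
  have nX' : X' != set0 by rewrite -card_gt0 -cX card_gt0.
  have nD' : V :\: X' != set0 by rewrite -card_gt0 -cD card_gt0.
  have cU := cardsID X U; rewrite (setIidPr sX) in cU.
  rewrite -!card_gt0 in nX nD.
  split; apply: IH => //.
  - by rewrite -cU in ltU; lia.
  - by apply: spset_sub spU _ _; rewrite // -card_gt0.
  - exact: spset_sub spV _ _.
  - by rewrite -cU in ltU; lia.
  - by apply: spset_sub spU _ _; rewrite ?subsetDl // -card_gt0.
  - by apply: spset_sub spV _ _; rewrite ?subsetDl.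
have splitU (X Y : {set T}) : X \subset Y -> Y = X :|: (Y :\: X).
  by move=> sXY; rewrite -{1}(setIidPr sXY) setID.
have connU : conn U -> set_iso U V.
  case=> [[x eU]|[A [B [nA nB AB eU]]]].
    have := nchains_card eN; rewrite eU cards1 => /esym/eqP/cards1P[y ->].
    exists (fun=> y); first by rewrite imset_set1.
    by move=> z t /set1P-> /set1P->; rewrite !lexx.
  have uA : unique_ideal U A by rewrite eU; apply: ordsum_unique_ideal.
  have [J uJ [eA eB]] := unique_ideal_eqN uA eN.
  have sAU := ideal_sub uA.1; have sJV := ideal_sub uJ.1.
  have nD : U :\: A != set0.
    have /set0Pn[b bB] := nB; apply/set0Pn; exists b; rewrite eU !inE bB orbT andbT.
    by apply/negP => bA; have := AB b b bA bB; rewrite ltxx.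
  have [isoA isoB] := step A J sAU sJV nA nD eA eB.
  rewrite (splitU A U sAU) (splitU J V sJV).
  by apply: set_iso_ordsum isoA isoB; apply: unique_ideal_ordsum.
have [S cS eU] := spset_components spU; have [S' cS' eV] := spset_components spV.
have [W WS [W' W'S' [eNW eNC]]] : exists2 W, W \in S & exists2 W', W' \in S' &
    (forall a, nchains a W = nchains a W') /\
    (forall a, nchains a (cover (S :\ W)) = nchains a (cover (S' :\ W'))).
  have /set0Pn[x] := spset_neq0 spU; rewrite -eU => /bigcupP[W0 W0S _].
  have W0SS' : W0 \in S :|: S' by rewrite inE W0S.
  have [W memW maxW] := arg_maxnP (fun W : {set T} => #|W|) W0SS'.
  have {memW} WSS' : W \in S :|: S' := memW.
  have bS : bounded #|W| S by move=> X XS; apply: (maxW X (subsetP (subsetUl S S') X XS)).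
  have bS' : bounded #|W| S' by move=> X XS; apply: (maxW X (subsetP (subsetUr S S') X XS)).
  rewrite -eU -eV in eN.
  (* If the largest component belongs to [V], [split_component] is applied with the sides
     exchanged. *)
  move: WSS'; rewrite inE => /orP[WS|WS'].
    by exists W => //; apply: split_component.
  have [X XS [eX eC]] := split_component cS' cS bS' bS WS' (fun a => esym (eN a)).
  by exists X => //; exists W => //; split=> a; rewrite ?eX ?eC.
have iW := indep_cover cS WS; have iW' := indep_cover cS' W'S'.
rewrite -!coverD1 // eU eV in iW iW' eNC.
have sW : W \subset U by rewrite -eU; apply: bigcup_sup.
have sW' : W' \subset V by rewrite -eV; apply: bigcup_sup.
have cW := cS.1 W WS.
(* Here [U = W] is a single component, that is, a point or an ordinal sum. *)
have [e0|nD] := eqVneq (U :\: W) set0.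
  by apply: connU; rewrite (splitU W U sW) e0 setU0.
have [isoW isoD] := step W W' sW sW' (conn_neq0 cW) nD eNW eNC.
by rewrite (splitU W U sW) (splitU W' V sW'); apply: set_iso_indep.
Qed.

End Ideals.

(** * Transfer along order embeddings *)

Lemma nchains_imset (dP dT : Order.disp_t) (P : finPOrderType dP) (T : finPOrderType dT)
    (f : P -> T) : {mono f : x y / (x <= y)%O} ->
  forall a (U : {set P}), nchains a (f @: U) = nchains a U.
Proof.
move=> mf; have injf : injective f.
  by move=> x y exy; apply/le_anti; rewrite -!mf exy lexx.
have fD (U J : {set P}) : f @: U :\: f @: J = f @: (U :\: J).
  apply/setP => y; rewrite inE; apply/andP/imsetP.
    case=> yJ /imsetP[x xU ey]; exists x => //; rewrite inE xU andbT.
    by apply: contra yJ => xJ; rewrite ey imset_f.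
  by case=> x; rewrite inE => /andP[xJ xU] ->; rewrite !mem_imset.
elim=> [|m a IH] U; first by rewrite /nchains imset_eq0.
rewrite !nchains_cons /conv (reindex_onto (fun J : {set P} => f @: J) (fun J => f @^-1: J)) /=.
  apply: eq_big => [J|J _]; last by rewrite card_imset // fD IH.
  have -> : f @^-1: (f @: J) == J by apply/eqP/setP => x; rewrite inE mem_imset.
  rewrite andbT; apply/idealP/idealP => -[sJ clJ]; split.
  - by apply/subsetP => x xJ; rewrite -(mem_imset U x injf) (subsetP sJ) ?imset_f.
  - move=> x y xJ yU lyx; rewrite -(mem_imset J y injf).
    by apply: (clJ (f x)); rewrite ?imset_f ?mf.
  - exact: imsetS.
  - move=> _ _ /imsetP[x xJ ->] /imsetP[y yU ->]; rewrite mf => lyx.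
    by rewrite imset_f // (clJ x).
move=> J /ideal_sub/subsetP sJ; apply/setP => y; apply/imsetP/idP => [[x]|yJ].
  by rewrite inE => fxJ ->.
have /imsetP[x _ ey] := sJ y yJ.
by exists x; rewrite // inE -ey.
Qed.

(** Quantifying over all embeddings lets the induction compose [f] with [inl], [inr] or an
    isomorphism. *)
Lemma series_parallel_spset (d : Order.disp_t) (P : finPOrderType d) :
  series_parallel P -> forall (dT : Order.disp_t) (T : finPOrderType dT) (f : P -> T),
  {mono f : x y / (x <= y)%O} -> spset (f @: [set: P]).
Proof.
elim=> {d P} [d P P1|dP dQ P Q _ IHP _ IHQ|dP dQ P Q _ IHP _ IHQ|
    dP dQ P Q _ IHP [g bg mg]] dT T f mf.
- have /eqP/cards1P[x ->] : #|[set: P]| = 1%N by rewrite cardsT.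
  by rewrite imset_set1; constructor.
- have -> : f @: [set: disj_union P Q] = (f \o inl) @: [set: P] :|: (f \o inr) @: [set: Q].
    apply/setP => y; rewrite inE; apply/imsetP/orP.
      by case=> -[x|x] _ ->; [left|right]; apply/imsetP; exists x.
    by case=> /imsetP[x _ ->]; [exists (inl x)|exists (inr x)].
  apply: spsetU.
  + by apply: IHP => x y; rewrite /= mf.
  + by apply: IHQ => x y; rewrite /= mf.
  + by move=> _ _ /imsetP[x _ ->] /imsetP[y _ ->]; rewrite /Order.comparable /= !mf.
- have -> : f @: [set: ord_sum P Q] = (f \o inl) @: [set: P] :|: (f \o inr) @: [set: Q].
    apply/setP => y; rewrite inE; apply/imsetP/orP.
      by case=> -[x|x] _ ->; [left|right]; apply/imsetP; exists x.
    by case=> /imsetP[x _ ->]; [exists (inl x)|exists (inr x)].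
  apply: spsetS.
  + by apply: IHP => x y; rewrite /= mf.
  + by apply: IHQ => x y; rewrite /= mf.
  + by move=> _ _ /imsetP[x _ ->] /imsetP[y _ ->]; rewrite lt_leAnge /= !mf.
- have -> : f @: [set: Q] = (f \o g) @: [set: P].
    have [h gK hK] := bg; apply/setP => y; apply/imsetP/imsetP => -[x _ ->].
      by exists (h x); rewrite //= hK.
    by exists (g x).
  by apply: IHP => x y; rewrite /= mf mg.
Qed.

(** * P-partitions as chains of ideals *)

Section Labelings.
Context (d : Order.disp_t) (P : finPOrderType d).
Implicit Types (U J : {set P}) (h : P -> nat) (a : seq nat).

(** Mirrors the recursion of [nchains]: the elements labelled [c.+1] form the first ideal, those
    labelled [c.+2] the next difference, and so on. *)
Fixpoint labeling a c U h :=
  if a is m :: a' then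
    let J := [set x in U | h x == c.+1] in
    [&& ideal U J, #|J| == m & labeling a' c.+1 (U :\: J) h]
  else U == set0.

Lemma labeling_gt a c U h x : labeling a c U h -> x \in U -> (c < h x)%N.
Proof.
elim: a c U => [|m a IH] c U /=; first by move/eqP->; rewrite inE.
case/and3P=> _ _ lab xU; have [-> //|nx] := eqVneq (h x) c.+1.
by apply: ltnW; apply: IH lab _; rewrite !inE xU /= nx.
Qed.

(** The fibre of the least admissible label of an order-preserving map is an ideal, and the
    induction peels it off. Past the end of [a], the default 0 of [nth] excludes larger labels. *)
Lemma labelingP a c U h :
  reflect [/\ forall x, x \in U -> (c < h x)%N,
              forall x y, x \in U -> y \in U -> (x <= y)%O -> (h x <= h y)%N
            & forall i, #|[set x in U | h x == (c + i).+1]| = nth 0%N a i]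
          (labeling a c U h).
Proof.
elim: a c U => [|m a IH] c U /=.
  apply: (iffP eqP) => [->|[gtc _ fib]].
    split=> [x|x y|i]; rewrite ?inE // nth_nil; apply: eq_card0 => x.
    by rewrite !inE.
  apply/eqP; rewrite -subset0; apply/subsetP => x xU.
  have := fib (h x - c.+1)%N; rewrite nth_nil => /card0_eq/(_ x).
  by rewrite !inE xU /= -addSn subnKC ?eqxx ?gtc.
set J := [set x in U | h x == c.+1].
have fibD i : [set x in U :\: J | h x == (c.+1 + i).+1] = [set x in U | h x == (c + i.+1).+1].
  apply/setP => x; rewrite !inE addSnnS; case: (x \in U); rewrite ?andbF //=.
  by case: eqP => [->|]; rewrite ?andbF // andbT; lia.
apply: (iffP and3P) => [[idJ /eqP cJ /[dup] labD /IH[gtD moD fib]]|[gtc mo fib]].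
  have gtc x : x \in U -> (c < h x)%N.
    move=> xU; have [-> //|nx] := eqVneq (h x) c.+1.
    by apply: ltnW; apply: gtD; rewrite !inE xU /= nx.
  split=> // [x y xU yU lxy|[|i]]; last 2 first.
  - by rewrite addn0.
  - by rewrite -fibD fib.
  have [hy|ny] := eqVneq (h y) c.+1.
    have /idealP[_ /(_ y x)] := idJ; rewrite !inE yU hy eqxx => /(_ isT xU lxy).
    by case/andP=> _ /eqP->.
  have [->|nx] := eqVneq (h x) c.+1; first exact: gtc.
  by apply: moD; rewrite ?inE ?xU ?yU ?nx ?ny.
split.
- apply/idealP; split=> [|x y]; first by apply/subsetP => x; rewrite inE => /andP[].
  rewrite !inE => /andP[xU /eqP hx] yU lyx; rewrite yU eqn_leq gtc // andbT.
  by rewrite -hx mo.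
- by rewrite -[m]/(nth 0%N (m :: a) 0) -fib addn0.
- apply/IH; split=> [x|x y|i].
  + by rewrite !inE => /andP[+ xU]; rewrite xU /= ltn_neqAle eq_sym gtc // andbT.
  + by rewrite !inE => /andP[_ xU] /andP[_ yU]; apply: mo.
  + by rewrite fibD fib.
Qed.

(** The bound [M] makes the functions finite in number, and pinning [h] to [e] outside [U] counts
    each labelling of [U] once. In the induction the fibre [J] of [c.+1] joins the pinned part, as
    recorded by [e']. *)
Lemma card_labeling M a c U (e : {ffun P -> 'I_M.+1}) : (c + size a <= M)%N ->
  (#|[set h : {ffun P -> 'I_M.+1} | labeling a c U (fun x => h x : nat) &&
      [forall x, (x \notin U) ==> (h x == e x)]]|%:R = nchains a U)%R.
Proof.
elim: a c U e => [|m a IH] c U e leM.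
  rewrite [RHS]/nchains; case: eqP => [->|/eqP nU] /=; last first.
    by rewrite eq_card0 // => h; rewrite !inE (negPf nU).
  rewrite (_ : [set h | _] = [set e]) ?cards1 //; apply/setP => h; rewrite !inE eqxx /=.
  apply/forallP/eqP => [eh|-> x]; last by rewrite eqxx implybT.
  by apply/ffunP => x; have := eh x; rewrite inE /= => /eqP.
rewrite nchains_cons /conv -sum1dep_card natr_sum.
pose fib (h : {ffun P -> 'I_M.+1}) := [set x in U | h x == c.+1 :> nat].
rewrite (partition_big fib (ideal U)) /=; last by move=> h /andP[/and3P[]].
apply: eq_bigr => J idJ.
have sJ := ideal_sub idJ.
case: eqP => [cJ|nJ]; last first.
  rewrite mul0r big1 // => h /andP[/andP[/and3P[_ /eqP cfib _] _] /eqP efib].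
  by case: nJ; rewrite -efib.
have ltc : (c.+1 < M.+1)%N by rewrite ltnS -addn1; move: leM => /=; lia.
pose e' : {ffun P -> 'I_M.+1} := [ffun x => if x \in J then Ordinal ltc else e x].
rewrite mul1r -(IH c.+1 _ e'); last by move: leM => /=; lia.
rewrite -sum1dep_card natr_sum; apply: eq_bigl => h.
rewrite -/(fib h); apply/idP/idP.
  case/andP=> /andP[/and3P[_ _ lab] /forallP eh] /eqP efib; rewrite efib in lab.
  rewrite lab; apply/forallP => x; rewrite !inE negb_and negbK ffunE; apply/implyP.
  case: ifP => [xJ _|_ /= xU]; last by have := eh x; rewrite xU.
  by move: xJ; rewrite -efib inE => /andP[_ hx]; apply/eqP/val_inj/eqP.
case/andP=> lab /forallP eh.
have efib : fib h = J.
  apply/setP => x; rewrite inE; case: (boolP (x \in J)) => xJ.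
    have := eh x; rewrite !inE xJ /= ffunE xJ => /eqP ->.
    by rewrite (subsetP sJ) //= eqxx.
  apply/negbTE/negP => /andP[xU /eqP hx].
  by have := labeling_gt lab (x := x); rewrite !inE xJ xU hx ltnn => /(_ isT).
rewrite efib eqxx idJ cJ eqxx lab /= andbT; apply/forallP => x; apply/implyP => xU.
have xJ : x \notin J by apply: contra xU; apply: (subsetP sJ).
by have := eh x; rewrite !inE (negPf xU) andbF /= ffunE (negPf xJ).
Qed.

End Labelings.

(** Variables are numbered from 1 and parts from 0, hence the shift [i.-1]. *)
Definition composition_monomial (a : seq nat) : monomial :=
  [fsfun i in [fset i in iota 1 (size a)]%fset => nth 0%N a i.-1 | 0%N].

Lemma composition_monomialE a i :
  composition_monomial a i = if i is i'.+1 then nth 0%N a i' else 0%N.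
Proof.
rewrite fsfunE !finmap.inE /= mem_iota; case: i => [|i] //=.
by rewrite add1n ltnS; case: ltnP => // lei; rewrite nth_default.
Qed.

Lemma Ppartition_labeling (d : Order.disp_t) (P : finPOrderType d) a
    (h : {ffun P -> nat}) :
  (is_Ppartition h /\ Ppart_monomial h = composition_monomial a) <->
  labeling a 0 [set: P] h.
Proof.
have fibE i : [set x in [set: P] | h x == i] = [set x | h x == i].
  by apply/setP => x; rewrite !inE.
split=> [[[h_gt0 hmo] eh]|/labelingP[h_gt0 hmo fib]].
  apply/labelingP; split=> [x _|x y _ _|i]; [exact: h_gt0|exact: hmo|].
  rewrite fibE; have /fsfunP/(_ i.+1) := eh.
  by rewrite composition_monomialE Ppart_monomialE cardsE.
split; first by split=> [x|x y]; [exact: h_gt0|exact: hmo].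
apply/fsfunP => -[|i]; rewrite Ppart_monomialE composition_monomialE.
  by apply: eq_card0 => x; rewrite !inE; apply/negbTE; rewrite -lt0n h_gt0.
by rewrite -fib fibE cardsE.
Qed.

(** A P-partition with this monomial has no label above [size a], so it is one of the bounded
    functions counted by [card_labeling]. *)
Lemma K_nchains (d : Order.disp_t) (P : finPOrderType d) a :
  K P (composition_monomial a) = nchains a [set: P].
Proof.
rewrite KE; set A := (X in fset_set X).
have finA : finite_set A.
  by apply: (sub_finite_set _ (@K_finite _ P (composition_monomial a))) => h [].
pose M := size a; pose g (h : {ffun P -> 'I_M.+1}) : {ffun P -> nat} := [ffun x => h x : nat].
have ginj : injective g.
  by move=> h1 h2 /ffunP e; apply/ffunP => x; apply/val_inj; have := e x; rewrite !ffunE.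
(* Nothing lies outside [[set: P]], so the constant [ord0] pins no value. *)
rewrite -(@card_labeling _ P M a 0 [set: P] [ffun=> ord0]) // natz.
set G := finset _; congr Posz.
have -> : fset_set A = [fset g h | h in G]%fset.
  apply/fsetP => h; rewrite in_fset_set //; apply/idP/imfsetP => /=.
    move=> /set_mem/Ppartition_labeling lab.
    have leM x : (h x < M.+1)%N.
      have /labelingP[h_gt0 _ fib] := lab; rewrite ltnNge; apply/negP => ltM.
      have := fib (h x).-1; rewrite nth_default; last first.
        by rewrite -ltnS prednK ?h_gt0 ?inE.
      by move/card0_eq/(_ x); rewrite !inE add0n prednK ?eqxx ?h_gt0 ?inE.
    exists [ffun x => Ordinal (leM x)]; last by apply/ffunP => x; rewrite !ffunE.
    rewrite inE; apply/andP; split; last by apply/forallP => x; rewrite inE.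
    by rewrite (_ : (fun x => _) = h) //; apply/funext => x; rewrite ffunE.
  case=> h' + ->; rewrite inE => /andP[lab _].
  apply/classical_sets.mem_set/Ppartition_labeling.
  by rewrite (_ : (g h' : P -> nat) = fun x => h' x : nat) //; apply/funext => x; rewrite ffunE.
by rewrite card_imfset //= -cardE.
Qed.

(** * Comparing the two posets *)

(** [disj_union P Q] serves as the common ambient poset of [P] and [Q]. *)
Lemma mono_inl (dP dQ : Order.disp_t) (P : finPOrderType dP) (Q : finPOrderType dQ) :
  {mono (inl : P -> disj_union P Q) : x y / (x <= y)%O}.
Proof. by []. Qed.

Lemma mono_inr (dP dQ : Order.disp_t) (P : finPOrderType dP) (Q : finPOrderType dQ) :
  {mono (inr : Q -> disj_union P Q) : x y / (x <= y)%O}.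
Proof. by []. Qed.

Theorem theorem5p2 (dP dQ : Order.disp_t)
    (P : finPOrderType dP) (Q : finPOrderType dQ)
    (spP : series_parallel P) (spQ : series_parallel Q)
    (eqK : K P = K Q) :
  poset_iso P Q.
Proof.
have mL := @mono_inl _ _ P Q; have mR := @mono_inr _ _ P Q.
have eN a : nchains a (inl @: [set: P] : {set disj_union P Q}) =
            nchains a (inr @: [set: Q] : {set disj_union P Q}).
  by rewrite (nchains_imset mL) (nchains_imset mR) -!K_nchains eqK.
have [f fP mf] :=
  spset_set_iso (series_parallel_spset spP mL) (series_parallel_spset spQ mR) eN.
have inlP x : inl x \in (inl @: [set: P] : {set disj_union P Q}) by rewrite imset_f ?inE.
have /fin_all_exists[g gE] x : exists y : Q, f (inl x) = inr y.
  have : f (inl x) \in (inr @: [set: Q] : {set disj_union P Q}) by rewrite -fP imset_f.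
  by case/imsetP=> y _ ->; exists y.
have mg : {mono g : x y / (x <= y)%O}.
  by move=> x y; rewrite -mR -!gE mf // mL.
exists g => //.
have ginj : injective g by move=> x y e; apply/le_anti; rewrite -!mg e lexx.
have /fin_all_exists[k kK] y : exists x : P, g x = y.
  have : inr y \in (inr @: [set: Q] : {set disj_union P Q}) by rewrite imset_f ?inE.
  by rewrite -fP => /imsetP[_ /imsetP[x _ ->]]; rewrite gE => -[->]; exists x.
by exists k => [x|//]; apply: ginj.
Qed.
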